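(* Let $k>1$ be a rational integer such that $k \equiv 11 \pmod{12}$ and such that $(1-\omega)^k - 1$ is an Eisenstein Mersenne prime. Then $\alpha = (1-\omega)^{k-1}\left[(1-\omega)^k - 1\right]$ is an even norm-perfect Eisenstein integer.
   Context: Let $\omega = e^{2\pi i/3} = \frac{-1+\sqrt{-3}}{2}$, so $1+\omega+\omega^2=0$, and let $\mathbb{Z}[\omega]=\{a+b\omega : a,b\in\mathbb{Z}\}$ be the ring of Eisenstein integers (a unique factorization domain with units $\pm1,\pm\omega,\pm\omega^2$). The norm is $N(a+b\omega)=a^2-ab+b^2$. An Eisenstein integer is called even if it is divisible by $1-\omega$ in $\mathbb{Z}[\omega]$, and odd otherwise. An Eisenstein Mersenne prime is a prime element of $\mathbb{Z}[\omega]$ of the form $(1-\omega)^p-1$ with $p$ a rational prime. Every nonzero $\nu\in\mathbb{Z}[\omega]$ is written as $\nu=\epsilon\prod_{q=1}^{s}\pi_q^{k_q}$, where $\epsilon$ is a unit, the $\pi_q$ are pairwise distinct primes each of the form $a+b\omega$ with $a>b\ge 0$ (the chosen associate), and the $k_q$ are positive integers. The complex sum of divisors function is $\sigma^\star(\nu)=\prod_{q=1}^{s}\frac{\pi_q^{k_q+1}-1}{\pi_q-1}$. An Eisenstein integer $\alpha$ is norm-perfect if $N[\sigma^\star(\alpha)] = 3\cdot N[\alpha]$. *)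

(* Defs.v *)
From HB Require Import structures.
From mathcomp Require Import all_boot all_order all_algebra all_field.
From mathcomp Require Import ring lra.
From mathcomp Require Import boolp classical_sets.

Set Implicit Arguments.
Unset Strict Implicit.
Unset Printing Implicit Defensive.

Import Order.TTheory GRing.Theory Num.Theory.

Local Open Scope ring_scope.

(* [Eis a b] is the Eisenstein integer a + b * omega; the embedding [eisC] into
   the complex numbers at the end of the ring construction fixes omega. *)
Record eisenstein : Type := Eis { eis1 : int; eisw : int }.

Definition pair_of_eis (x : eisenstein) : int * int := (eis1 x, eisw x).
Definition eis_of_pair (u : int * int) : eisenstein := Eis u.1 u.2.

Lemma pair_of_eisK : cancel pair_of_eis eis_of_pair.
Proof. by case. Qed.

HB.instance Definition _ := Choice.copy eisenstein (can_type pair_of_eisK).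

Lemma eis_eqP (x y : eisenstein) : eis1 x = eis1 y -> eisw x = eisw y -> x = y.
Proof. by case: x y => [a b] [c d] /= -> ->. Qed.

Definition eis_add (x y : eisenstein) := Eis (eis1 x + eis1 y) (eisw x + eisw y).
Definition eis_opp (x : eisenstein) := Eis (- eis1 x) (- eisw x).

Fact eis_addA : associative eis_add.
Proof. by move=> x y z; apply: eis_eqP; rewrite /= addrA. Qed.
Fact eis_addC : commutative eis_add.
Proof. by move=> x y; apply: eis_eqP; rewrite /= addrC. Qed.
Fact eis_add0 : left_id (Eis 0 0) eis_add.
Proof. by move=> x; apply: eis_eqP; rewrite /= add0r. Qed.
Fact eis_addN : left_inverse (Eis 0 0) eis_opp eis_add.
Proof. by move=> x; apply: eis_eqP; rewrite /= addNr. Qed.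

HB.instance Definition _ :=
  GRing.isZmodule.Build eisenstein eis_addA eis_addC eis_add0 eis_addN.

(* (a + b w)(c + d w) with w ^ 2 = -1 - w. *)
Definition eis_mul (x y : eisenstein) :=
  Eis (eis1 x * eis1 y - eisw x * eisw y)
      (eis1 x * eisw y + eisw x * eis1 y - eisw x * eisw y).

Fact eis_mulA : associative eis_mul.
Proof. by move=> x y z; apply: eis_eqP => /=; ring. Qed.
Fact eis_mulC : commutative eis_mul.
Proof. by move=> x y; apply: eis_eqP => /=; ring. Qed.
Fact eis_mul1 : left_id (Eis 1 0) eis_mul.
Proof. by move=> x; apply: eis_eqP => /=; ring. Qed.
Fact eis_mulDl : left_distributive eis_mul +%R.
Proof. by move=> x y z; apply: eis_eqP => /=; ring. Qed.
Fact eis_1neq0 : Eis 1 0 != 0.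
Proof. by apply/eqP => - []. Qed.

HB.instance Definition _ := GRing.Zmodule_isComNzRing.Build eisenstein
  eis_mulA eis_mulC eis_mul1 eis_mulDl eis_1neq0.

Definition eis_norm (x : eisenstein) : int :=
  eis1 x ^+ 2 - eis1 x * eisw x + eisw x ^+ 2.

Lemma eis_normM : {morph eis_norm : x y / x * y}.
Proof. by move=> [a b] [c d]; rewrite /eis_norm /=; ring. Qed.

Lemma eis_norm_ge0 (x : eisenstein) : 0 <= eis_norm x.
Proof. by case: x => a b; rewrite /eis_norm /=; nra. Qed.

Lemma eis_norm_eq0 (x : eisenstein) : (eis_norm x == 0) = (x == 0).
Proof.
apply/eqP/eqP => [|-> //]; case: x => a b; rewrite /eis_norm /= => h.
have ha : a = 0 by apply/eqP; rewrite -sqrf_eq0 eq_le sqr_ge0 andbT; nra.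
have hb : b = 0 by apply/eqP; rewrite -sqrf_eq0 eq_le sqr_ge0 andbT; nra.
by rewrite ha hb.
Qed.

(* The complex conjugate: conj w = w ^ 2 = -1 - w. *)
Definition eis_conj (x : eisenstein) : eisenstein :=
  Eis (eis1 x - eisw x) (- eisw x).

Lemma eis_mul_conj (x : eisenstein) : eis_conj x * x = Eis (eis_norm x) 0.
Proof. by apply: eis_eqP; rewrite /eis_norm /=; ring. Qed.

Definition eis_unit : pred eisenstein := fun x => eis_norm x == 1.
Definition eis_inv (x : eisenstein) : eisenstein :=
  if eis_unit x then eis_conj x else x.

Fact eis_mulV : {in eis_unit, left_inverse 1 eis_inv *%R}.
Proof.
move=> x; rewrite -topredE /= /eis_inv => hx; rewrite hx eis_mul_conj.
by move/eqP: hx => ->.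
Qed.

Fact eis_unitPl (x y : eisenstein) : y * x = 1 -> eis_unit x.
Proof.
move=> /(congr1 eis_norm); rewrite eis_normM /eis_unit => h.
have hx := eis_norm_ge0 x; have hy := eis_norm_ge0 y.
case: (eis_norm x) (eis_norm y) hx hy h => [m|//] [n|//] _ _ /eqP.
by rewrite mulrC -PoszM !eqz_nat muln_eq1 => /andP[].
Qed.

Fact eis_inv_out : {in [predC eis_unit], eis_inv =1 id}.
Proof. by move=> x; rewrite inE -topredE /= /eis_inv => /negbTE ->. Qed.

HB.instance Definition _ := GRing.ComNzRing_hasMulInverse.Build eisenstein
  eis_mulV eis_unitPl eis_inv_out.

Fact eis_mulf_eq0 (x y : eisenstein) : x * y = 0 -> (x == 0) || (y == 0).
Proof.
by move=> /eqP; rewrite -(eis_norm_eq0 (x * y)) eis_normM mulf_eq0 !eis_norm_eq0.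
Qed.

HB.instance Definition _ :=
  GRing.ComUnitRing_isIntegral.Build eisenstein eis_mulf_eq0.

Definition omega : eisenstein := Eis 0 1.

Definition omegaC : algC := (-1 + sqrtC (-3%:R)) / 2%:R.
Definition eisC (x : eisenstein) : algC := (eis1 x)%:~R + (eisw x)%:~R * omegaC.

Lemma omegaC_sqr : omegaC ^+ 2 = - 1 - omegaC.
Proof.
have h : sqrtC (-3%:R : algC) ^+ 2 = - 3%:R by rewrite sqrtCK.
rewrite /omegaC; move: (sqrtC _) h => s h.
have -> : ((-1 + s) / 2%:R) ^+ 2 = (1 - 2%:R * s + s ^+ 2) / 4%:R by field.
by rewrite h; field.
Qed.

Fact eisC_is_zmod_morphism : zmod_morphism eisC.
Proof. by move=> x y; rewrite /eisC /= !rmorphB /=; ring. Qed.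

HB.instance Definition _ :=
  GRing.isZmodMorphism.Build eisenstein algC eisC eisC_is_zmod_morphism.

Fact eisC_is_monoid_morphism : monoid_morphism eisC.
Proof.
split=> [|x y]; first by rewrite /eisC /= mul0r addr0.
rewrite /eisC /= !(rmorphB, rmorphD, rmorphM) /=.
have -> (a b c d w : algC) :
  (a + b * w) * (c + d * w) = a * c + (a * d + b * c) * w + b * d * w ^+ 2.
  by ring.
by rewrite omegaC_sqr; ring.
Qed.

HB.instance Definition _ :=
  GRing.isMonoidMorphism.Build eisenstein algC eisC eisC_is_monoid_morphism.

Lemma eisC_omega : eisC omega = omegaC.
Proof. by rewrite /eisC /= add0r mul1r. Qed.

Lemma eisC_inj : injective eisC.
Proof.
apply: raddf_inj => x hx.
have : eisC (eis_conj x * x) = 0 by rewrite rmorphM /= hx mulr0.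
rewrite eis_mul_conj /eisC /= mul0r addr0 => /eqP.
by rewrite intr_eq0 eis_norm_eq0 => /eqP.
Qed.

Definition eis_dvd (d x : eisenstein) : Prop := exists q, x = q * d.

Definition eis_even (x : eisenstein) : Prop := eis_dvd (1 - omega) x.

Definition eis_prime (p : eisenstein) : Prop :=
  [/\ p != 0, p \isn't a GRing.unit &
      forall x y, eis_dvd p (x * y) -> eis_dvd p x \/ eis_dvd p y].

Definition eis_mersenne_prime (x : eisenstein) : Prop :=
  eis_prime x /\ exists2 p : nat, prime p & x = (1 - omega) ^+ p - 1.

Definition eis_chosen (x : eisenstein) : bool :=
  (eisw x < eis1 x) && (0 <= eisw x).

(* The entry (p, k) of s stands for the prime power p ^ k. *)
Definition eis_factorization (nu eps : eisenstein) (s : seq (eisenstein * nat)) :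
    Prop :=
  [/\ eps \is a GRing.unit,
      uniq [seq q.1 | q <- s],
      forall q, q \in s -> [/\ eis_prime q.1, eis_chosen q.1 & (0 < q.2)%N] &
      nu = eps * \prod_(q <- s) q.1 ^+ q.2].

(* The exact quotient in Z[omega]; 0 when y does not divide x. *)
Definition eis_quot (x y : eisenstein) : eisenstein :=
  xget 0 [set q | x = q * y]%classic.

Lemma eis_quotK (x y : eisenstein) : y != 0 -> eis_quot (x * y) y = x.
Proof.
move=> y0; rewrite /eis_quot; case: xgetP => [q _ /= /(mulIf y0) -> //|].
by move=> /(_ x) /=; case.
Qed.

(* The product read off a factorization of nu, which is unique up to the order
   of the factors; the default value 1 is only taken at nu = 0, where the
   sum of divisors is undefined (and 0 is then not norm-perfect). *)
Definition sigma_star (nu : eisenstein) : eisenstein :=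
  xget 1 [set t | exists eps s, eis_factorization nu eps s /\
    t = \prod_(q <- s) eis_quot (q.1 ^+ q.2.+1 - 1) (q.1 - 1)]%classic.

Definition norm_perfect (alpha : eisenstein) : Prop :=
  eis_norm (sigma_star alpha) = 3 * eis_norm alpha.

(* Main.v *)
(** [(1 - omega) ^+ 2 = - 3 omega], so for [k = 11 %[mod 12]] the power
    [(1 - omega) ^+ k] is [t (2 + omega)] with [t = 3 ^ ((k - 1) / 2)], and the
    Mersenne prime [M = (2 t - 1) + t omega] is its own chosen associate, while
    the chosen associate of [1 - omega] is [2 + omega]. Hence
    [sigma_star alpha] is [((2 + omega) ^+ k - 1) / (1 + omega) * (M + 1)].
    Moreover [(2 + omega) ^+ k = t (1 - omega)], so [(2 + omega) ^+ k - 1] and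
    [M] both have norm [3 t ^ 2 - 3 t + 1], and [M + 1] has norm [3 ^ k]. *)
Require Import Defs.
From mathcomp Require Import all_boot all_order all_algebra.
From mathcomp Require Import zify ring.
From mathcomp Require Import classical_sets.

Import Order.TTheory GRing.Theory Num.Theory.

Local Open Scope ring_scope.

Lemma eis_unitE (x : eisenstein) : (x \is a GRing.unit) = (eis_norm x == 1).
Proof. by []. Qed.

Lemma eis_prime_dvd_assoc (p q : eisenstein) :
  eis_prime p -> eis_prime q -> eis_dvd p q ->
  exists2 c, c \is a GRing.unit & q = c * p.
Proof.
move=> [p0 pU _] [q0 qU qP] [c qE]; exists c => //.
have [|[d cE]|[d pE]] := qP c p; first by exists 1; rewrite mul1r.
- case/negP: pU; apply/unitrPr; exists d; apply: (mulfI q0).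
  by rewrite mulr1 [RHS]qE cE; ring.
- apply/unitrPr; exists d; apply: (mulIf q0).
  by rewrite mul1r [RHS]qE pE; ring.
Qed.

(* The six units rotate the plane by multiples of 60 degrees, and the chosen
   associates are those in a half-open sector of angle 60 degrees. *)
Lemma eis_chosen_assoc (c p : eisenstein) :
  c \is a GRing.unit -> eis_chosen p -> eis_chosen (c * p) -> c = 1.
Proof.
case: c p => [x y] [a b]; rewrite eis_unitE /eis_norm /eis_chosen /=.
move=> /eqP cU /andP[ab b0] /andP[].
(* Norm 1 gives [(2 y - x) ^ 2 + 3 x ^ 2 = 4], and symmetrically in [x] and [y], so only nine
   candidates for [c] remain. *)
have hx : -1 <= x <= 1 by apply/andP; split; nia.
have hy : -1 <= y <= 1 by apply/andP; split; nia.
have /or3P : [|| x == -1, x == 0 | x == 1] by lia.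
have /or3P : [|| y == -1, y == 0 | y == 1] by lia.
by move=> [] /eqP yE [] /eqP xE; subst x y; move=> h1 h2 //; exfalso; lia.
Qed.

Lemma eis_chosen_prime_dvd (p q : eisenstein) :
  eis_prime p -> eis_chosen p -> eis_prime q -> eis_chosen q ->
  eis_dvd p q -> p = q.
Proof.
move=> pP pC qP qC /(eis_prime_dvd_assoc _ _ pP qP) [c cU qE].
by move: qC; rewrite qE => /(eis_chosen_assoc _ _ cU pC) ->; rewrite mul1r.
Qed.

Lemma eis_prime_dvd_unit (p u : eisenstein) :
  eis_prime p -> u \is a GRing.unit -> ~ eis_dvd p u.
Proof.
move=> [_ pU _] uU [q uE]; case/negP: pU.
by move: uU; rewrite uE unitrM => /andP[].
Qed.

Lemma eis_prime_dvd_prod (p : eisenstein) (s : seq eisenstein) :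
  eis_prime p -> eis_dvd p (\prod_(q <- s) q) ->
  exists2 q, q \in s & eis_dvd p q.
Proof.
move=> pP; elim: s => [|q s IHs].
  by rewrite big_nil => /(eis_prime_dvd_unit _ _ pP (unitr1 _)).
rewrite big_cons; have [_ _ pM] := pP => /pM[pq|/IHs[r rs pr]].
  by exists q; rewrite ?mem_head.
by exists r; rewrite // in_cons rs orbT.
Qed.

(** Unique factorization for lists of primes with repetition: the head of [s1] divides some member
    of [s2], equals it because both are chosen, and cancels. *)
Lemma eis_chosen_primes_perm (s1 s2 : seq eisenstein) (e1 e2 : eisenstein) :
  e1 \is a GRing.unit -> e2 \is a GRing.unit ->
  (forall q, q \in s1 -> eis_prime q /\ eis_chosen q) ->
  (forall q, q \in s2 -> eis_prime q /\ eis_chosen q) ->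
  e1 * \prod_(q <- s1) q = e2 * \prod_(q <- s2) q -> perm_eq s1 s2.
Proof.
move=> e1U e2U; elim: s1 s2 => [|p s1 IHs] s2 P1 P2.
  case: s2 P2 => [//|q s2] P2; have [qP _] := P2 q (mem_head _ _).
  rewrite big_nil big_cons mulr1 => e1E.
  case: (eis_prime_dvd_unit _ _ qP e1U); exists (e2 * \prod_(j <- s2) j).
  by rewrite e1E; ring.
have [pP pC] := P1 p (mem_head _ _); rewrite big_cons => E.
have [q qs2 pq] : exists2 q, q \in s2 & eis_dvd p q.
  apply: eis_prime_dvd_prod => //; exists (e2^-1 * e1 * \prod_(q <- s1) q).
  by rewrite -[LHS](mulKr e2U) -E; ring.
have [qP qC] := P2 q qs2.
have pE := eis_chosen_prime_dvd _ _ pP pC qP qC pq.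
rewrite -pE in qs2; rewrite perm_sym (permPl (perm_to_rem qs2)) perm_cons perm_sym.
apply: IHs => [r rs1|r /mem_rem /P2 //|].
  by apply: P1; rewrite in_cons rs1 orbT.
have [p0 _ _] := pP; apply: (mulfI p0).
move: E; rewrite (perm_big _ (perm_to_rem qs2)) /= big_cons => E.
by rewrite mulrCA E; ring.
Qed.

Lemma prod_tally_seq (s : seq (eisenstein * nat)) :
  \prod_(q <- tally_seq s) q = \prod_(q <- s) q.1 ^+ q.2.
Proof.
elim: s => [|[q n] s IHs]; first by rewrite !big_nil.
rewrite big_cons /= -IHs [tally_seq _]/= big_cat /=; congr (_ * _).
by rewrite big_nseq iter_mulr_1.
Qed.

Lemma mem_tally_seq (T : eqType) (s : seq (T * nat)) (x : T) :
  x \in tally_seq s -> exists2 q, q \in s & x = q.1.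
Proof. by case/flatten_mapP => q qs /nseqP[-> _]; exists q. Qed.

(** Replacing each [(p, n)] by [n] copies of [p] reduces this to lists of primes. Distinct bases and
    positive exponents are what lets [tally] recover the pairs. *)
Lemma eis_factorization_perm (nu e1 e2 : eisenstein)
    (s1 s2 : seq (eisenstein * nat)) :
  eis_factorization nu e1 s1 -> eis_factorization nu e2 s2 -> perm_eq s1 s2.
Proof.
move=> [e1U u1 P1 nu1] [e2U u2 P2 nu2].
have wf s : uniq [seq q.1 | q <- s] ->
    (forall q : eisenstein * nat, q \in s ->
       [/\ eis_prime q.1, eis_chosen q.1 & (0 < q.2)%N]) -> s \is a wf_tally _.
  move=> us Ps; rewrite unfold_in; apply/andP; split=> //.
  by apply/negP => /mapP[q /Ps[_ _]]; case: q.2.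
have flatP s : (forall q : eisenstein * nat, q \in s ->
       [/\ eis_prime q.1, eis_chosen q.1 & (0 < q.2)%N]) ->
    forall q, q \in tally_seq s -> eis_prime q /\ eis_chosen q.
  by move=> Ps q /mem_tally_seq[r /Ps[rP rC _] ->].
have : perm_eq (tally_seq s1) (tally_seq s2).
  apply: (eis_chosen_primes_perm _ _ e1 e2) => //; try exact: flatP.
  by rewrite !prod_tally_seq -nu1.
by move=> /perm_tally; rewrite !tally_seqK // wf.
Qed.

Lemma sigma_starE (nu eps : eisenstein) (s : seq (eisenstein * nat)) :
  eis_factorization nu eps s ->
  sigma_star nu = \prod_(q <- s) eis_quot (q.1 ^+ q.2.+1 - 1) (q.1 - 1).
Proof.
move=> nuE; rewrite /sigma_star; case: xgetP => [_ _ [e [r [nuE' ->]]]|].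
  exact/perm_big/(eis_factorization_perm _ _ _ _ _ nuE' nuE).
by case/(_ (\prod_(q <- s) eis_quot (q.1 ^+ q.2.+1 - 1) (q.1 - 1))); exists eps, s.
Qed.

Lemma eis_normX (x : eisenstein) (n : nat) : eis_norm (x ^+ n) = eis_norm x ^+ n.
Proof. by elim: n => // n IHn; rewrite !exprS eis_normM IHn. Qed.

Lemma eis_intX (a : int) (n : nat) : Eis a 0 ^+ n = Eis (a ^+ n) 0.
Proof.
elim: n => [//|n IHn]; rewrite !exprS IHn.
by apply: eis_eqP; rewrite /= ?mul0r ?mulr0 ?subr0 ?addr0.
Qed.

(** Modulo [2 + omega], [omega] is congruent to -2, hence to 1, since 3 is the norm of
    [2 + omega]. *)
Lemma eis_dvd_2Domega (x : eisenstein) :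
  eis_dvd (Eis 2 1) x <-> (3 %| eis1 x + eisw x)%Z.
Proof.
case: x => a b /=; split=> [[[c d] [-> ->]]|/dvdzP[m mE]].
  by apply/dvdzP; exists c; ring.
by exists (Eis m (b - m)); apply: eis_eqP => /=; lia.
Qed.

Lemma eis_prime_2Domega : eis_prime (Eis 2 1).
Proof.
split=> // -[a b] [c d] /eis_dvd_2Domega /= h.
(* The sum of the coordinates is multiplicative modulo 3: it is reduction to the field with three
   elements. *)
have : (3 %| (a + b) * (c + d))%Z.
  have -> : (a + b) * (c + d) = a * c - b * d + (a * d + b * c - b * d) + b * d * 3.
    by ring.
  by rewrite rpredD ?h ?dvdz_mull.
by rewrite dvdzE abszM Euclid_dvdM // => /orP[] ?; [left|right]; apply/eis_dvd_2Domega.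
Qed.

(** Both bases have square 3 times a unit, and their twelfth powers are exactly [3 ^ 6]. *)
Lemma expr_omega_mod12 (m : nat) :
  (1 - omega) ^+ (12 * m + 11) = Eis (2 * 3 ^+ (6 * m + 5)) (3 ^+ (6 * m + 5)) /\
  (Eis 2 1) ^+ (12 * m + 11) = Eis (3 ^+ (6 * m + 5)) (- 3 ^+ (6 * m + 5)).
Proof.
have E12 : (1 - omega) ^+ 12 = Eis (3 ^+ 6) 0 by [].
have F12 : (Eis 2 1) ^+ 12 = Eis (3 ^+ 6) 0 by [].
have E11 : (1 - omega) ^+ 11 = Eis (2 * 3 ^+ 5) (3 ^+ 5) by [].
have F11 : (Eis 2 1) ^+ 11 = Eis (3 ^+ 5) (- 3 ^+ 5) by [].
rewrite !(exprD _ (_ * m)) !(exprM _ _ m) E12 F12 E11 F11 !eis_intX.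
move: ((3 ^+ 6) ^+ m) (3 ^+ 5) => u v.
by split; apply: eis_eqP => /=; ring.
Qed.

Theorem theorem4p3 (k : nat) (hk : (1 < k)%N) (hmod : (k = 11 %[mod 12])%N)
    (hM : eis_mersenne_prime ((1 - omega) ^+ k - 1)) :
  let alpha := (1 - omega) ^+ (k - 1) * ((1 - omega) ^+ k - 1) in
  eis_even alpha /\ norm_perfect alpha.
Proof.
move=> alpha; split.
  exists ((1 - omega) ^+ (k - 2) * ((1 - omega) ^+ k - 1)).
  rewrite /alpha (_ : k - 1 = (k - 2).+1)%N; last by lia.
  by rewrite exprS; ring.
have [MP _] := hM; rewrite /alpha /norm_perfect.
have kE : k = (12 * (k %/ 12) + 11)%N by lia.
have [] := expr_omega_mod12 (k %/ 12); rewrite -kE.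
set t := 3 ^+ _ => lamk pik.
(* This bound separates [M] from [2 + omega], which would need [t = 1]. *)
have t3 : 3 <= t by rewrite /t addnS exprS ler_peMr // exprn_ege1.
set M := (1 - omega) ^+ k - 1 in MP *.
have ME : M = Eis (2 * t - 1) t by rewrite /M lamk; apply: eis_eqP => /=; ring.
(* The unit here is [- omega]; its power [k - 1] is the unit part of [alpha]. *)
have lamE : 1 - omega = Eis 0 (-1) * Eis 2 1 by apply: eis_eqP.
have fact : eis_factorization ((1 - omega) ^+ (k - 1) * M)
    (Eis 0 (-1) ^+ (k - 1)) [:: (Eis 2 1, k - 1)%N; (M, 1%N)].
  split.
  - by rewrite unitrX.
  - rewrite /= andbT inE; apply/eqP; rewrite ME => - [_ tE].
    by move: t3; rewrite -tE.
  - move=> q; rewrite !inE => /orP[] /eqP -> /=; split=> //.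
    + exact: eis_prime_2Domega.
    + by lia.
    + by rewrite ME /eis_chosen /=; lia.
  - by rewrite !big_cons big_nil /= lamE exprMn; ring.
have M1 : M - 1 != 0 by rewrite ME; apply/eqP => - [_ tE]; move: t3; lia.
have quotM : eis_quot (M ^+ 2 - 1) (M - 1) = M + 1.
  by rewrite -(eis_quotK (M + 1) M1); congr (eis_quot _ _); ring.
have quotpi : eis_norm (eis_quot (Eis 2 1 ^+ k - 1) (Eis 2 1 - 1)) = eis_norm M.
  have [x xE] : exists x, Eis 2 1 ^+ k - 1 = x * (Eis 2 1 - 1).
    by eexists; rewrite subrX1 mulrC.
  rewrite xE eis_quotK //.
  have : eis_norm (x * (Eis 2 1 - 1)) = eis_norm M.
    by rewrite -xE pik ME /eis_norm /=; ring.
  (* The denominator [1 + omega] has norm 1. *)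
  by rewrite eis_normM mulr1.
rewrite (sigma_starE _ _ _ fact) !big_cons big_nil /= mulr1 quotM.
rewrite (_ : (k - 1).+1 = k)%N; last by lia.
(* [M + 1] is [(1 - omega) ^+ k], one factor [1 - omega] more than in [alpha]; its norm is the
   required 3. *)
rewrite eis_normM quotpi subrK !eis_normM !eis_normX.
rewrite [in LHS](_ : k = (k - 1).+1)%N; last by lia.
by rewrite exprS (_ : eis_norm (1 - omega) = 3) //; ring.
Qed.
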